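(* There exists a logic $\mathcal L$ (over some algebraic language) such that the Leibniz operator $\Omega\colon\mathrm{Th}\mathcal L\to\mathrm{Con}\,\mathbf{Fm}$ is injective, but for some algebra $\mathbf A$ the Leibniz operator $\Omega^{\mathbf A}$ restricted to $\mathcal{F}i_{\mathcal L}\mathbf A$ is not injective. That is, injectivity of the Leibniz operator does not in general transfer from theories to deductive filters over arbitrary algebras.
   Context: Fix an algebraic type and a countably infinite set of variables; $Fm$ is the set of formulas, $\mathbf{Fm}$ the formula algebra. A logic $\mathcal L$ is a structural closure operator on $\mathcal P(Fm)$ (i.e. $\sigma[C(\Gamma)]\subseteq C(\sigma[\Gamma])$ for every substitution $\sigma$); $\Gamma\vdash_{\mathcal L}\varphi$ means $\varphi\in C(\Gamma)$. A deductive filter of $\mathcal L$ over an algebra $\mathbf A$ is $F\subseteq A$ such that $\Gamma\vdash_{\mathcal L}\varphi$ and $h[\Gamma]\subseteq F$ for a homomorphism $h\colon\mathbf{Fm}\to\mathbf A$ imply $h(\varphi)\in F$; $\mathcal{F}i_{\mathcal L}\mathbf A$ is the set of these, and $\mathrm{Th}\mathcal L=\mathcal{F}i_{\mathcal L}\mathbf{Fm}$. The Leibniz congruence $\Omega^{\mathbf A}F$ is the largest congruence of $\mathbf A$ compatible with $F$; $\Omega=\Omega^{\mathbf{Fm}}$. *)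

(* Defs.v *)
From mathcomp Require Import all_boot.
From mathcomp Require Import boolp classical_sets functions.
Set Implicit Arguments.
Unset Strict Implicit.
Unset Printing Implicit Defensive.

Local Open Scope classical_set_scope.

Record signature : Type := Signature {
  symbol :> Type;
  arity : symbol -> nat
}.

Record algebra (S : signature) : Type := Algebra {
  carrier :> Type;
  op : forall s : S, ('I_(arity s) -> carrier) -> carrier;
  carrier_inhabited : inhabited carrier
}.

Definition homomorphism (S : signature) (A B : algebra S) (h : A -> B) : Prop :=
  forall (s : S) (x : 'I_(arity s) -> A), h (op x) = op (h \o x).

(* The countably infinite set of variables is [nat]. *)
Inductive formula (S : signature) : Type :=
| Var of nat
| App (s : S) of ('I_(arity s) -> formula S).

Arguments Var {S}.

Definition Fm (S : signature) : algebra S :=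
  @Algebra S (formula S) (@App S) (inhabits (Var 0)).

Record logic (S : signature) : Type := Logic {
  Cn :> set (Fm S) -> set (Fm S);
  Cn_extensive : forall G, G `<=` Cn G;
  Cn_monotone : forall G D, G `<=` D -> Cn G `<=` Cn D;
  Cn_idempotent : forall G, Cn (Cn G) = Cn G;
  Cn_structural : forall (sigma : Fm S -> Fm S), homomorphism sigma ->
    forall G, sigma @` Cn G `<=` Cn (sigma @` G)
}.

Definition entails (S : signature) (L : logic S) (G : set (Fm S)) (p : Fm S) :
  Prop := L G p.

Definition deductive_filter (S : signature) (L : logic S) (A : algebra S)
    (F : set A) : Prop :=
  forall (G : set (Fm S)) (p : Fm S), entails L G p ->
  forall h : Fm S -> A, homomorphism h -> h @` G `<=` F -> F (h p).

Definition Fi (S : signature) (L : logic S) (A : algebra S) : set (set A) :=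
  [set F | deductive_filter L F].

Arguments Fi {S} L A.

Definition Th (S : signature) (L : logic S) : set (set (Fm S)) := Fi L (Fm S).

Record congruence (S : signature) (A : algebra S) (th : A -> A -> Prop) : Prop :=
  Congruence {
    cong_refl : forall a, th a a;
    cong_sym : forall a b, th a b -> th b a;
    cong_trans : forall a b c, th a b -> th b c -> th a c;
    cong_op : forall (s : S) (x y : 'I_(arity s) -> A),
      (forall i, th (x i) (y i)) -> th (op x) (op y)
  }.

Definition Con (S : signature) (A : algebra S) : set (A -> A -> Prop) :=
  [set th | congruence th].

Arguments Con {S} A.

Definition compatible (S : signature) (A : algebra S) (th : A -> A -> Prop)
    (F : set A) : Prop :=
  forall a b, th a b -> F a -> F b.

Definition largest_compatible_congruence (S : signature) (A : algebra S)
    (F : set A) (th : A -> A -> Prop) : Prop :=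
  [/\ Con A th, compatible th F &
      forall th', Con A th' -> compatible th' F ->
        forall a b, th' a b -> th a b].

Lemma largest_compatible_congruence_uniq (S : signature) (A : algebra S)
    (F : set A) (th th' : A -> A -> Prop) :
  largest_compatible_congruence F th -> largest_compatible_congruence F th' ->
  th = th'.
Proof.
move=> [c k m] [c' k' m']; apply/funext => a; apply/funext => b.
by apply/propext; split; [apply: m' | apply: m].
Qed.

Section LeibnizExistence.
Variables (S : signature) (A : algebra S) (F : set A).

Definition subst1 (s : S) (i : 'I_(arity s)) (x : 'I_(arity s) -> A) (a : A) :=
  fun j => if j == i then a else x j.

Inductive translation : (A -> A) -> Prop :=
| translation_id : translation id
| translation_op f (s : S) (i : 'I_(arity s)) (x : 'I_(arity s) -> A) :
    translation f -> translation (fun a => f (op (subst1 i x a))).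

Definition indis (a b : A) := forall f, translation f -> F (f a) <-> F (f b).

Lemma largest_compatible_congruence_exists :
  exists th : A -> A -> Prop, largest_compatible_congruence F th.
Proof.
exists indis; split.
- split.
  + by move=> a f _.
  + by move=> a b ab f /ab[].
  + by move=> a b c ab bc f tf; rewrite (ab f tf) (bc f tf).
  + move=> s x y xy f tf.
    pose z k := fun j : 'I_(arity s) => if (j < k)%N then y j else x j.
    have zP k : (k <= arity s)%N -> F (f (op x)) <-> F (f (op (z k))).
      elim: k => [_|k IH lek]; first by have -> : z 0 = x by exact/funext.
      rewrite (IH (ltnW lek)); pose i := Ordinal lek.
      have zk : z k = subst1 i (z k) (x i).
        apply/funext => j; rewrite /subst1; case: eqP => // ->.
        by rewrite /z ltnn.
      have zk1 : z k.+1 = subst1 i (z k) (y i).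
        apply/funext => j; rewrite /subst1 /z ltnS leq_eqVlt -val_eqE /=.
        case: eqP => //= jk; congr y; exact: val_inj.
      rewrite zk1 {1}zk; exact: (xy i _ (translation_op i (z k) tf)).
    rewrite (zP _ (leqnn _)); have -> // : z (arity s) = y.
    by apply/funext => j; rewrite /z ltn_ord.
- by move=> a b /(_ _ translation_id)[].
- move=> th cth kth a b ab f tf.
  suff fab : th (f a) (f b).
    by split; apply: kth => //; exact: cong_sym.
  elim: tf a b ab => [//|g s i x _ IH] a b ab; apply: IH.
  apply: cong_op => // j; rewrite /subst1; case: ifP => // _.
  exact: cong_refl.
Qed.

End LeibnizExistence.

Definition Leibniz (S : signature) (A : algebra S) (F : set A) : A -> A -> Prop :=
  projT1 (cid (largest_compatible_congruence_exists F)).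

Arguments Leibniz {S} A F.

Lemma LeibnizP (S : signature) (A : algebra S) (F : set A) :
  largest_compatible_congruence F (Leibniz A F).
Proof. exact: projT2 (cid (largest_compatible_congruence_exists F)). Qed.

(* Main.v *)
(** The signature has a constant 1, uncountably many constants u_s and a binary
    product.  The algebra A consists of 1, 0, the u_s and elements p_s, where
    u_s * p_s = 1 and every other product is 0.  The logic is the one induced
    by the two matrices (A, {1}) and (A, {1} U {u_s}).  Thanks to the parameters
    p_s, both filters have the identity as Leibniz congruence on A.  In Fm, on
    the other hand, the role of p_s can only be played by variables, each for at
    most one s; there being countably many variables, a theory containing the
    u_s must make some u_s congruent to 1, so its Leibniz congruence tells it
    apart from the theories that omit them. *)
Require Import Defs.
From mathcomp Require Import all_boot.
From mathcomp Require Import boolp classical_sets functions.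
Set Implicit Arguments.
Unset Strict Implicit.
Unset Printing Implicit Defensive.

Local Open Scope classical_set_scope.

(** Cantor's diagonal argument: [D] collects the codes of sets that omit their own code. *)
Lemma no_injection_set_nat (g : set nat -> nat) : ~ injective g.
Proof.
move=> ginj; pose D : set nat := [set n | exists s, g s = n /\ ~ s n].
have DgD : ~ D (g D) by move=> DgD; case: (DgD) => s [/ginj-> []].
by apply: (DgD); exists D.
Qed.

(** * Logics induced by a family of matrices on one algebra *)

Section MatrixLogic.
Variables (S : signature) (A : algebra S) (I : Type) (F : I -> set A).

Definition model (G : set (Fm S)) (i : I) (h : Fm S -> A) : Prop :=
  homomorphism h /\ forall q, G q -> F i (h q).

Definition matrix_cn (G : set (Fm S)) : set (Fm S) :=
  [set p | forall i h, model G i h -> F i (h p)].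

Lemma matrix_cn_extensive G : G `<=` matrix_cn G.
Proof. by move=> p Gp i h [_]; apply. Qed.

Lemma matrix_cn_monotone G D : G `<=` D -> matrix_cn G `<=` matrix_cn D.
Proof. by move=> GD p Gp i h [hh hD]; apply: Gp; split=> // q /GD/hD. Qed.

Lemma matrix_cn_idempotent G : matrix_cn (matrix_cn G) = matrix_cn G.
Proof.
apply/seteqP; split; last exact: matrix_cn_extensive.
move=> p Gp i h hG; apply: Gp; split; first by case: hG.
by move=> q; apply.
Qed.

Lemma matrix_cn_structural (sigma : Fm S -> Fm S) : homomorphism sigma ->
  forall G, sigma @` matrix_cn G `<=` matrix_cn (sigma @` G).
Proof.
move=> hs G _ [p Gp <-] i h [hh hG]; apply: (Gp i (h \o sigma)).
split=> [s x|q Gq] /=; first by rewrite hs hh.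
by apply: hG; exists q.
Qed.

Definition matrix_logic : logic S :=
  Logic matrix_cn_extensive matrix_cn_monotone matrix_cn_idempotent
    matrix_cn_structural.

Lemma matrix_filter i : Fi matrix_logic A (F i).
Proof.
move=> G p Gp h hh hG; apply: Gp; split=> // q Gq.
by apply: hG; exists q.
Qed.

(** The filter condition at the identity homomorphism; it lets membership in a theory be checked in
    models. *)
Lemma theoryP (T : set (Fm S)) p : Th matrix_logic T ->
  (forall i h, model T i h -> F i (h p)) -> T p.
Proof.
move=> thT Tp; apply: (thT T p Tp id); first by [].
by move=> _ [q Tq <-].
Qed.

End MatrixLogic.

(** * The signature, the algebra and its two filters *)

Inductive sym : Type := One | U of set nat | Mul.

Definition sig : signature :=
  @Signature sym (fun s => if s is Mul then 2 else 0).

Inductive elt : Type := one | zero | u of set nat | p of set nat.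

Definition mulA (a b : elt) : elt :=
  match a, b with
  | u s, p t => if `[< s = t >] then one else zero
  | _, _ => zero
  end.

Definition opA (s : sym) : ('I_(@arity sig s) -> elt) -> elt :=
  match s return ('I_(@arity sig s) -> elt) -> elt with
  | One => fun=> one
  | U s => fun=> u s
  | Mul => fun x => mulA (x ord0) (x ord_max)
  end.

Definition A : algebra sig := @Algebra sig elt opA (inhabits one).

Definition F (b : bool) : set A :=
  fun a => match a with one => True | u _ => b | _ => False end.

Definition L : logic sig := matrix_logic F.

Lemma mulAE a b : mulA a b = one -> exists s, a = u s /\ b = p s.
Proof. by case: a b => // s [] //= t; case: asboolP => // ->; exists t. Qed.

Lemma mulA_not_u x y s : mulA x y <> u s.
Proof. by case: x y => [||t|t] [||r|r] //=; case: asboolP. Qed.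

Lemma mulA_not_p x y s : mulA x y <> p s.
Proof. by case: x y => [||t|t] [||r|r] //=; case: asboolP. Qed.

Lemma mulA_up s : mulA (u s) (p s) = one.
Proof. by rewrite /=; case: asboolP. Qed.

(** Products take only the values [one] and [zero], on which both filters agree. *)
Lemma F_mulA b x y : F b (mulA x y) <-> mulA x y = one.
Proof.
split=> [|->] //; case: x => //= s; case: y => //= t.
by case: asboolP.
Qed.

(** * Products and the Leibniz congruences on [A] *)

Definition pair2 (B : algebra sig) (a b : B) : 'I_2 -> B :=
  fun i => if i == ord0 then a else b.

Definition mul (B : algebra sig) (a b : B) : B := @op sig B Mul (pair2 a b).

Lemma op_Mul (B : algebra sig) (x : 'I_2 -> B) :
  @op sig B Mul x = mul (x ord0) (x ord_max).
Proof.
congr op; apply/funext => i; rewrite /pair2; case: eqP => [->//|i0].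
congr x; apply/val_inj; case: i i0 => -[|[]] //= lt i0.
by case: i0; apply/val_inj.
Qed.

Lemma hom_mul (B : algebra sig) (h : B -> A) a b :
  homomorphism h -> h (mul a b) = mulA (h a) (h b).
Proof. by move=> hh; rewrite /mul hh. Qed.

Lemma congruence_mul (B : algebra sig) (th : B -> B -> Prop) a a' b b' :
  congruence th -> th a a' -> th b b' -> th (mul a b) (mul a' b').
Proof.
by move=> cth aa bb; apply: cong_op => // i; rewrite /pair2; case: ifP.
Qed.

(** Only [u s] gives [one] when multiplied by [p s] on the right, and only [p s] when multiplied by
    [u s] on the left. So these elements are congruent only to themselves, and the filter separates
    [one] from [zero]. *)
Lemma compatible_F_eq b (th : A -> A -> Prop) : congruence th ->
  compatible th (F b) -> forall x y, th x y -> x = y.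
Proof.
move=> cth kth.
have kmul x y x' y' : th x x' -> th y y' -> mulA x y = one -> mulA x' y' = one.
  by move=> xx yy /(F_mulA b)/(kth _ _ (congruence_mul cth xx yy))/F_mulA.
have thu s y : th (u s) y -> u s = y.
  by move=> /kmul/(_ (cong_refl cth _) (mulA_up s))/mulAE[t [-> [->]]].
have thp s y : th (p s) y -> p s = y.
  by move=> /(kmul _ _ _ _ (cong_refl cth _))/(_ (mulA_up s))/mulAE[t [[->]]].
move=> [||s|s] y; [| |exact: thu|exact: thp].
- by case: y => // [/kth/(_ I)|s /(cong_sym cth)/thu|s /(cong_sym cth)/thp].
- by case: y => // [/(cong_sym cth)/kth/(_ I)|s /(cong_sym cth)/thu
                   |s /(cong_sym cth)/thp].
Qed.

Lemma Leibniz_F b : Leibniz A (F b) = eq.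
Proof.
have [c k _] := LeibnizP (F b).
apply/funext => x; apply/funext => y; apply/propext; split.
  exact: (compatible_F_eq c k).
by move=> ->; exact: (cong_refl c).
Qed.

Lemma Leibniz_A_not_inj : ~ set_inj (Fi L A) (Leibniz A).
Proof.
move=> /(_ (F true) (F false)); rewrite !inE => inj.
have FE : F true = F false.
  by apply: inj; rewrite ?Leibniz_F //; exact: matrix_filter.
by have : F false (u set0) by rewrite -FE.
Qed.


(* The dummy argument [Var 0] is never read: [One] and [U s] have arity 0. *)
Definition const (s : sym) : Fm sig := @App sig s (fun=> Var 0).

(** * Theories of the logic and their Leibniz congruences *)

Section Theory.
Variables (T : set (Fm sig)) (thT : Th L T).

Lemma inconsistent_theory q : (forall b h, ~ model F T b h) -> T q.
Proof. by move=> noT; apply: (theoryP thT) => b h /noT. Qed.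

Lemma theory_one : T (const One).
Proof. by apply: (theoryP thT) => b h [hh _]; rewrite hh. Qed.

(** In a model, a product in [T] has value [one], so its left factor has some value [u s] and its
    right factor [p s]. Neither value is taken by [One] or by a product, so here and in the next
    three lemmas [T] has no model. *)
Lemma theory_one_mul a q : T (mul (const One) a) -> T q.
Proof.
move=> Ta; apply: inconsistent_theory => b h [hh /(_ _ Ta)].
rewrite (hom_mul _ _ hh) => /F_mulA/mulAE[s []].
by rewrite hh.
Qed.

Lemma theory_mul_one a q : T (mul a (const One)) -> T q.
Proof.
move=> Ta; apply: inconsistent_theory => b h [hh /(_ _ Ta)].
rewrite (hom_mul _ _ hh) => /F_mulA/mulAE[s [_]].
by rewrite hh.
Qed.

Lemma theory_mul_mull a c d q : T (mul (mul a c) d) -> T q.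
Proof.
move=> Ta; apply: inconsistent_theory => b h [hh /(_ _ Ta)].
by rewrite !(hom_mul _ _ hh) => /F_mulA/mulAE[s [/mulA_not_u]].
Qed.

Lemma theory_mul_mulr a c d q : T (mul d (mul a c)) -> T q.
Proof.
move=> Ta; apply: inconsistent_theory => b h [hh /(_ _ Ta)].
by rewrite !(hom_mul _ _ hh) => /F_mulA/mulAE[s [_ /mulA_not_p]].
Qed.

(** A right factor would take a value [p s], which lies in neither filter. *)
Lemma theory_mul_r a c q : T a -> T (mul c a) -> T q.
Proof.
move=> Ta Tca; apply: inconsistent_theory => b h [hh hT].
move: (hT _ Tca) (hT _ Ta); rewrite (hom_mul _ _ hh) => /F_mulA/mulAE[s [_ ->]].
by [].
Qed.

(** In a model [a] has a value [u t] in the filter, so the filter is [F true] and contains every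
    [u s]. *)
Lemma theory_u_of_mul a c s : T a -> T (mul a c) -> T (const (U s)).
Proof.
move=> Ta Tac; apply: (theoryP thT) => b h [hh hT].
move: (hT _ Tac) (hT _ Ta); rewrite (hom_mul _ _ hh) => /F_mulA/mulAE[t [-> _]].
by rewrite hh.
Qed.

Lemma theory_of_mul_u a c s : T (const (U s)) -> T (mul a c) -> T a.
Proof.
move=> Tu Tac; apply: (theoryP thT) => b h [hh hT].
move: (hT _ Tac) (hT _ Tu); rewrite (hom_mul _ _ hh) => /F_mulA/mulAE[t [-> _]].
by rewrite hh.
Qed.

Lemma theory_u_mul_inj s t c q :
  T (mul (const (U s)) c) -> T (mul (const (U t)) c) -> ~ T q -> s = t.
Proof.
move=> Ts Tt nTq; apply: contrapT => st; apply: nTq.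
apply: inconsistent_theory => b h [hh hT].
move: (hT _ Ts) (hT _ Tt); rewrite !(hom_mul _ _ hh) !hh.
move=> /F_mulA/mulAE[s' [[<-] ->]] /F_mulA/mulAE[t' [[<-] [/st]]].
by [].
Qed.

(** The right factor must take the value [p s], but no operation of [A] has a value of this form. *)
Lemma theory_u_mul_var s c q :
  T (mul (const (U s)) c) -> ~ T q -> exists n, c = Var n.
Proof.
move=> Ts nTq; case: c Ts => [n|f x] Ts; first by exists n.
case: nTq; apply: inconsistent_theory => b h [hh /(_ _ Ts)].
rewrite (hom_mul _ _ hh) => /F_mulA/mulAE[t [_]].
rewrite (hh f x); case: f x {Ts} => //= x; exact: mulA_not_p.
Qed.

(* A nested product in T makes T everything, so translations with a single
   product suffice to describe the Leibniz congruence. *)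
Definition equi (a a' : Fm sig) : Prop :=
  [/\ T a <-> T a', forall c, T (mul a c) <-> T (mul a' c) &
      forall c, T (mul c a) <-> T (mul c a')].

Lemma equi_congruence : congruence equi.
Proof.
split=> [a|a b [ab1 ab2 ab3]|a b c [ab1 ab2 ab3] [bc1 bc2 bc3]|s x y xy].
- by split.
- by split=> [|c|c]; apply: iff_sym.
- by split=> [|d|d]; [rewrite ab1|rewrite ab2|rewrite ab3].
- case: s x y xy => [|s|] x y xy.
  + by have -> : x = y by apply/funext => -[].
  + by have -> : x = y by apply/funext => -[].
  + rewrite (op_Mul x) (op_Mul y); split.
    * have [_ -> _] := xy ord0; have [_ _ ->] := xy ord_max.
      by [].
    * by move=> c; split; apply: theory_mul_mull.
    * by move=> c; split; apply: theory_mul_mulr.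
Qed.

Lemma equi_Leibniz a a' : equi a a' -> Leibniz (Fm sig) T a a'.
Proof.
have [_ _ max] := LeibnizP T; apply: max; first exact: equi_congruence.
by move=> c d [cd _ _] /cd.
Qed.

Lemma Leibniz_one a : Leibniz (Fm sig) T a (const One) -> T a.
Proof.
have [c k _] := LeibnizP T.
by move=> /(cong_sym c)/k; apply; exact: theory_one.
Qed.

(** As left factors, [a] never yields a member of [T] and [One] does so only if [T] is everything,
    which the hypothesis on [a] excludes. As right factors, both force [T] to be everything. *)
Lemma Leibniz_one_of_no_mul a : T a -> (forall c, ~ T (mul a c)) ->
  Leibniz (Fm sig) T a (const One).
Proof.
move=> Ta nTa; apply: equi_Leibniz; split=> [|c|c].
- by split=> // _; exact: theory_one.
- by split=> [/nTa|/theory_one_mul] //; apply.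
- split=> [Tca|/theory_mul_one]; last by apply.
  exact: theory_mul_r Ta Tca.
Qed.

Lemma Leibniz_one_mul a c : T (mul a c) ->
  Leibniz (Fm sig) T (mul a c) (const One).
Proof.
move=> Tac; apply: equi_Leibniz; split=> [|d|d].
- by split=> // _; exact: theory_one.
- by split=> [/theory_mul_mull|/theory_one_mul]; apply.
- by split=> [/theory_mul_mulr|/theory_mul_one]; apply.
Qed.

Lemma Leibniz_one_u : (forall s, T (const (U s))) ->
  exists s, Leibniz (Fm sig) T (const (U s)) (const One).
Proof.
move=> Tu; have [[q nTq]|allT] := pselect (exists q, ~ T q); last first.
  have {}allT q : T q by apply: contrapT => nTq; apply: allT; exists q.
  (* If [T] contains all formulas, any two are [equi]; the choice of [set0] is arbitrary. *)
  by exists set0; apply: equi_Leibniz.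
have [[s nTs]|mulT] :=
    pselect (exists s, forall c, ~ T (mul (const (U s)) c)).
  by exists s; apply: Leibniz_one_of_no_mul.
(* Otherwise each [U s] has a right partner in [T], necessarily a variable; as no two share one, [g]
   would be injective. *)
have /choice[g gP] s : exists n, T (mul (const (U s)) (Var n)).
  apply: contrapT => nTs; apply: mulT; exists s => c Tc.
  have [n cn] := theory_u_mul_var Tc nTq.
  by apply: nTs; exists n; rewrite -cn.
exfalso; apply: (@no_injection_set_nat g) => s t gst.
by apply: (theory_u_mul_inj (gP s) _ nTq); rewrite gst.
Qed.

End Theory.

(** Members of the shared class of [One] lie in [T']. If [a] is not itself in it, some product
    [mul a c] is, and so is some [U s]; together these put [a] into [T']. *)
Lemma Leibniz_subset T T' : Th L T -> Th L T' ->
  Leibniz (Fm sig) T = Leibniz (Fm sig) T' -> T `<=` T'.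
Proof.
move=> thT thT' TT' a Ta.
have one_T' q : Leibniz (Fm sig) T q (const One) -> T' q.
  by rewrite TT'; exact: Leibniz_one.
have [[c Tac]|nTa] := pselect (exists c, T (mul a c)); last first.
  apply/one_T'/Leibniz_one_of_no_mul => // c Tac.
  by apply: nTa; exists c.
have Tu s : T (const (U s)) by exact: theory_u_of_mul Ta Tac.
have [s /one_T' T's] := Leibniz_one_u thT Tu.
by apply: (theory_of_mul_u thT' T's); exact/one_T'/Leibniz_one_mul/Tac.
Qed.

Theorem theorem6p7 :
  exists (S : signature) (L : logic S),
    set_inj (Th L) (Leibniz (Fm S)) /\
    exists A : algebra S, ~ set_inj (Fi L A) (Leibniz A).
Proof.
exists sig, L; split; last by exists A; exact: Leibniz_A_not_inj.
move=> T T'; rewrite !inE => thT thT' TT'.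
by apply/seteqP; split; apply: Leibniz_subset.
Qed.
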